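(* Let $G$ be a weight matrix, $\Omega\subset\mathbb R^n$ open, $\mathcal H:\Omega\times\mathbb R\to\mathbb R$, and let $u\in C^2(\Omega,\mathbb R)$ be a graph of prescribed weighted mean curvature $\mathcal H$. Then $u$ satisfies the quasilinear elliptic differential equation $$\sum_{i,j=1}^n G_{ij}(-\nabla u,1)\,\partial_{ij}u=\mathcal H(x,u)\quad\text{in }\Omega$$ (elliptic meaning that the $n\times n$ matrix $(G_{ij}(-\nabla u,1))_{1\le i,j\le n}$ is positive definite).
   Context: A weight matrix is a map $G=G(p)=(G_{ij}(p))_{i,j=1}^{n+1}$ from $\mathbb R^{n+1}\setminus\{0\}$ to the symmetric real $(n+1)\times(n+1)$ matrices such that (i) $\langle G(p)y,y\rangle>0$ for all $p\neq 0$ and all $y\in p^\perp\setminus\{0\}$; (ii) $t\,G(tp)=G(p)$ and $G(p)p=0$ for all $p\ne0$, $t>0$. For an immersion $X$ with unit normal $N$ put $g_{ij}=\langle\partial_iX,\partial_jX\rangle$, $b_{ij}=\langle\partial_{ij}X,N\rangle$, $S=g^{-1}b$, $A_G=(a_{ij})$ with $a_{ij}=\langle G(N)\partial_iX,\partial_jX\rangle$. The weighted mean curvature is $H_G=\mathrm{tr}(g^{-1}A_GS)$. The function $u$ is a graph of prescribed weighted mean curvature $\mathcal H$ if the immersion $X(x)=(x,u(x))$ with upper normal $N=(1+|\nabla u|^2)^{-1/2}(-\nabla u,1)$ satisfies $H_G(x)=\mathcal H(x,u(x))$ for all $x\in\Omega$. *)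

(* Defs.v *)
From HB Require Import structures.
From mathcomp Require Import all_boot all_order all_algebra.
From mathcomp Require Import all_classical all_reals all_analysis.

Set Implicit Arguments.
Unset Strict Implicit.
Unset Printing Implicit Defensive.

Import Order.TTheory GRing.Theory Num.Theory.
Import numFieldNormedType.Exports.

Local Open Scope classical_set_scope.
Local Open Scope ring_scope.

(* Points of R^n are column vectors, and R^(n+1) is 'cV[R]_(n + 1), so that   *)
(* the pair (x, t) of R^n x R is col_mx x t%:M and the first n coordinates    *)
(* are indexed by lshift 1 i.                                                 *)

Definition dot (R : realType) (n : nat) (v w : 'cV[R]_n) : R :=
  \sum_(i < n) v i 0 * w i 0.

(* Symmetry is part of the notion. *)
Definition posdefmx (R : realType) (n : nat) (M : 'M[R]_n) : Prop :=
  M^T = M /\ forall v : 'cV[R]_n, v != 0 -> 0 < dot (M *m v) v.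

(* Maps on R^{n+1} \ {0} are total functions; the value at 0 is irrelevant. *)
Record weight_matrix (R : realType) (n : nat)
    (G : 'cV[R]_(n + 1) -> 'M[R]_(n + 1)) : Prop := WeightMatrix {
  weight_sym : forall p, p != 0 -> (G p)^T = G p ;
  weight_pos : forall p, p != 0 ->
    forall y, dot y p = 0 -> y != 0 -> 0 < dot (G p *m y) y ;
  weight_homo : forall p, p != 0 -> forall t : R, 0 < t ->
    t *: G (t *: p) = G p ;
  weight_ker : forall p, p != 0 -> G p *m p = 0 }.

Definition partial (R : realType) (n : nat) (V : normedModType R)
    (i : 'I_n) (f : 'cV[R]_n -> V) : 'cV[R]_n -> V :=
  'D_(delta_mx i 0) f.

(* C^k on an open set Om, for a function whose values outside Om are          *)
(* irrelevant: all iterated partial derivatives of order at most k exist and  *)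
(* are continuous at every point of Om.                                       *)
Fixpoint Ck_on (R : realType) (n : nat) (k : nat) (Om : set 'cV[R]_n)
    (f : 'cV[R]_n -> R) : Prop :=
  (forall x, Om x -> {for x, continuous f}) /\
  (if k is k'.+1 then
     forall i : 'I_n,
       (forall x, Om x -> derivable f x (delta_mx i 0)) /\
       Ck_on k' Om (partial i f)
   else True).

Definition grad (R : realType) (n : nat) (u : 'cV[R]_n -> R) (x : 'cV[R]_n) :
    'cV[R]_n :=
  \col_(i < n) partial i u x.

Section Hypersurface.
Variables (R : realType) (n : nat).
Variable G : 'cV[R]_(n + 1) -> 'M[R]_(n + 1).
Variables X N : 'cV[R]_n -> 'cV[R]_(n + 1).

Definition first_form (x : 'cV[R]_n) : 'M[R]_n :=
  \matrix_(i < n, j < n) dot (partial i X x) (partial j X x).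

Definition second_form (x : 'cV[R]_n) : 'M[R]_n :=
  \matrix_(i < n, j < n) dot (partial i (partial j X) x) (N x).

Definition shape_operator (x : 'cV[R]_n) : 'M[R]_n :=
  invmx (first_form x) *m second_form x.

Definition weight_form (x : 'cV[R]_n) : 'M[R]_n :=
  \matrix_(i < n, j < n) dot (G (N x) *m partial i X x) (partial j X x).

Definition weighted_mean_curvature (x : 'cV[R]_n) : R :=
  \tr (invmx (first_form x) *m weight_form x *m shape_operator x).

End Hypersurface.

Section Graph.
Variables (R : realType) (n : nat) (u : 'cV[R]_n -> R).

Definition graph_immersion (x : 'cV[R]_n) : 'cV[R]_(n + 1) :=
  col_mx x (u x)%:M.

(* The non-normalized upper normal (-grad u, 1). *)
Definition graph_conormal (x : 'cV[R]_n) : 'cV[R]_(n + 1) :=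
  col_mx (- grad u x) 1%:M.

Definition upper_normal (x : 'cV[R]_n) : 'cV[R]_(n + 1) :=
  (Num.sqrt (1 + dot (grad u x) (grad u x)))^-1 *: graph_conormal x.

End Graph.

Definition prescribed_wmc_graph (R : realType) (n : nat)
    (G : 'cV[R]_(n + 1) -> 'M[R]_(n + 1)) (Om : set 'cV[R]_n)
    (H : 'cV[R]_n -> R -> R) (u : 'cV[R]_n -> R) : Prop :=
  forall x, Om x ->
    weighted_mean_curvature G (graph_immersion u) (upper_normal u) x =
    H x (u x).

(* Main.v *)
(* Write a = grad u and q = (-a, 1), let A be the upper left n x n block of    *)
(* G(q), E = (1; a^T) the Jacobian matrix of the graph and g = 1 + a a^T its   *)
(* first fundamental form.  The columns of E and of (g; 0) agree modulo q,     *)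
(* which spans the kernel of the symmetric matrix G(q), so E^T G(q) E = g A g. *)
(* With W = |q|, homogeneity turns G(q / W) into W G(q), while the second      *)
(* fundamental form is the Hessian of u divided by W; hence g^-1 A_G S is      *)
(* A times the Hessian.  Likewise G(q) takes the same value on (v, 0) and on   *)
(* its projection to the orthogonal of q, so that A is positive definite.      *)

Require Import Defs.
From HB Require Import structures.
From mathcomp Require Import all_boot all_order all_algebra.
From mathcomp Require Import all_classical all_reals all_analysis.

Set Implicit Arguments.
Unset Strict Implicit.
Unset Printing Implicit Defensive.

Import Order.TTheory GRing.Theory Num.Theory.
Import numFieldNormedType.Exports.

Local Open Scope classical_set_scope.
Local Open Scope ring_scope.

(** Since [G q] is symmetric and kills q = (-grad u, 1), neither of its arguments sees multiples of
    q. Trading tangent vectors for horizontal ones therefore turns the weight form into W g A g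
    ([weight_form_factor]). In H_G both factors g meet an inverse, and W meets the 1/W of the second
    form, leaving tr(A D) with D the Hessian ([weighted_mean_curvature_graph]). Trading horizontal
    vectors for vectors orthogonal to q gives ellipticity ([posdef_ulsubmx]). *)

Lemma dotE (R : realType) (n : nat) (v w : 'cV[R]_n) :
  dot v w = (v^T *m w) 0 0.
Proof. by rewrite /dot mxE; apply: eq_bigr => i _; rewrite mxE. Qed.

Lemma dot_col_mx (R : realType) (m n : nat) (v v' : 'cV[R]_m) (w w' : 'cV[R]_n) :
  dot (col_mx v w) (col_mx v' w') = dot v v' + dot w w'.
Proof. by rewrite !dotE tr_col_mx mul_row_col mxE. Qed.

Lemma dot_ge0 (R : realType) (n : nat) (v : 'cV[R]_n) : 0 <= dot v v.
Proof. by apply: sumr_ge0 => i _; rewrite -expr2 sqr_ge0. Qed.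

(** Sherman-Morrison gives the inverse explicitly; its denominator 1 + |a|^2 is positive. *)
Lemma unitmx_add1_outer (R : realType) (n : nat) (a : 'cV[R]_n) :
  1%:M + a *m a^T \in unitmx.
Proof.
pose s := dot a a; have s1_neq0 : 1 + s != 0.
  by rewrite gt_eqF// ltr_pwDl// dot_ge0.
have aTa : a^T *m a = s%:M by rewrite [LHS]mx11_scalar -dotE.
suff: (1%:M + a *m a^T) *m (1%:M - (1 + s)^-1 *: (a *m a^T)) = 1%:M.
  by case/mulmx1_unit.
rewrite mulmxBr mulmx1 -scalemxAr mulmxDl mul1mx -!mulmxA (mulmxA a^T) aTa.
rewrite mul_scalar_mx -scalemxAr -{2}(scale1r (a *m a^T)) -scalerDl scalerA.
by rewrite mulVf// scale1r addrK.
Qed.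

Lemma weight_form_factor (R : realType) (n : nat) (K : 'M[R]_(n + 1))
    (a : 'cV[R]_n) (E := col_mx 1%:M a^T) (g := 1%:M + a *m a^T) :
  K^T = K -> K *m col_mx (- a) 1%:M = 0 ->
  E^T *m K *m E = g *m ulsubmx K *m g.
Proof.
move=> Ksym Kq; pose F : 'M[R]_(n + 1, n) := col_mx 1%:M 0.
have KE : K *m E = K *m F *m g.
  (* Column j of [E] is column j of (g; 0) plus a_j q. *)
  have -> : E = F *m g + col_mx (- a) 1%:M *m a^T.
    rewrite mul_col_mx mul1mx mul0mx mul_col_mx mulNmx mul1mx add_col_mx.
    by rewrite addrK add0r.
  by rewrite mulmxDr (mulmxA K _ a^T) Kq mul0mx addr0 mulmxA.
have gT : g^T = g by rewrite linearD /= trmx1 trmx_mul trmxK.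
have EK : E^T *m K = g *m (F^T *m K).
  by rewrite -{1}Ksym -trmx_mul KE !trmx_mul gT Ksym.
rewrite EK -!mulmxA KE !mulmxA -(mulmxA g) -(mulmxA g); congr (_ *m _ *m _).
rewrite -{1}(submxK K) tr_col_mx mul_row_block trmx1 trmx0 !mul1mx !mul0mx.
by rewrite !addr0 mul_row_col mulmx1 mulmx0 addr0.
Qed.

Lemma conormal_neq0 (R : realType) (n : nat) (a : 'cV[R]_n) :
  col_mx a 1%:M != 0 :> 'cV[R]_(n + 1).
Proof. by rewrite col_mx_eq0 negb_and oner_neq0 orbT. Qed.

Lemma posdef_ulsubmx (R : realType) (n : nat)
    (G : 'cV[R]_(n + 1) -> 'M[R]_(n + 1)) (hG : weight_matrix G)
    (a : 'cV[R]_n) : posdefmx (ulsubmx (G (col_mx a 1%:M))).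
Proof.
set q := col_mx a 1%:M; have q0 : q != 0 by exact: conormal_neq0.
have Ksym := weight_sym hG q0; have Kq := weight_ker hG q0.
set K := G q in Ksym Kq *; split; first by rewrite trmx_ulsub Ksym.
move=> v v0; pose w : 'cV[R]_(n + 1) := col_mx v 0.
have qq_gt0 : 0 < dot q q.
  rewrite dot_col_mx ltr_wpDl ?dot_ge0//.
  by rewrite /dot big_ord1 mxE eqxx mulr1.
(* [y] is the projection of (v, 0) onto the orthogonal complement of q, where positivity of [K] is
   known. *)
pose s := dot w q / dot q q; pose y := w - s *: q.
have yq : dot y q = 0.
  rewrite dotE /y linearB /= linearZ /= mulmxBl -scalemxAl.
  rewrite [LHS]mxE [X in _ + X]mxE [X in - X]mxE -!dotE.
  by rewrite divfK ?subrr ?gt_eqF.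
(* The last entry of [y] is -s, so y = 0 would force s = 0 and then v = 0. *)
have y0 : y != 0.
  apply: contra v0; rewrite /y scale_col_mx opp_col_mx add_col_mx col_mx_eq0.
  case/andP=> vE; rewrite add0r oppr_eq0 scaler_eq0 oner_eq0 orbF => /eqP s0.
  by rewrite s0 scale0r subr0 in vE.
have Ky : K *m y = K *m w by rewrite mulmxBr -scalemxAr Kq scaler0 subr0.
have := weight_pos hG q0 yq y0; rewrite -/K Ky.
have -> : dot (K *m w) y = dot (K *m w) w.
  rewrite !dotE mulmxBr -scalemxAr trmx_mul Ksym -!mulmxA Kq mulmx0.
  by rewrite scaler0 subr0.
rewrite -{1}(submxK K) mul_block_col !mulmx0 !addr0 dot_col_mx.
by rewrite /dot [X in _ + X]big_ord1 [(0 : 'cV__) _ _]mxE mulr0 addr0.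
Qed.

Lemma derivable_coord (R : realType) (n : nat) (i : 'I_n) (t v : 'cV[R]_n) :
  derivable (fun y : 'cV[R]_n => y i 0) t v.
Proof. by have /derivable_mxP := @derivable_id R _ t v; apply. Qed.

Lemma derive_coord (R : realType) (n : nat) (i : 'I_n) (t v : 'cV[R]_n) :
  'D_v (fun y : 'cV[R]_n => y i 0) t = v i 0.
Proof.
have := derive_mx (@derivable_id R _ t v).
by rewrite derive_id => /matrixP/(_ i 0); rewrite mxE.
Qed.

Lemma derive_col_mx_scalar (R : realType) (m n : nat)
    (f : 'cV[R]_n -> 'cV[R]_m) (h : 'cV[R]_n -> R) (t v : 'cV[R]_n) :
  derivable f t v -> derivable h t v ->
  'D_v (fun y => col_mx (f y) (h y)%:M : 'cV[R]_(m + 1)) t =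
  col_mx ('D_v f t) ('D_v h t)%:M.
Proof.
move=> df dh; have dfi := (derivable_mxP f t v).1 df.
have E1 i : (fun y => col_mx (f y) (h y)%:M (lshift 1 i) 0) = fun y => f y i 0.
  by apply/funext => y; rewrite col_mxEu.
have E2 i : (fun y => col_mx (f y) (h y)%:M (rshift m i) 0) = h.
  by apply/funext => y; rewrite col_mxEd ord1 mxE eqxx mulr1n.
rewrite derive_mx; last first.
  apply/derivable_mxP => k j; rewrite ord1.
  by case: (split_ordP k) => i ->; rewrite ?E1 ?E2.
apply/matrixP => k j; rewrite ord1 mxE; case: (split_ordP k) => i ->.
  by rewrite E1 col_mxEu (derive_mx df) mxE.
by rewrite E2 col_mxEd ord1 mxE eqxx mulr1n.
Qed.

Lemma partial_graph_immersion (R : realType) (n : nat) (u : 'cV[R]_n -> R)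
    (i : 'I_n) (x : 'cV[R]_n) :
  derivable u x (delta_mx i 0) ->
  partial i (graph_immersion u) x = col_mx (delta_mx i 0) (partial i u x)%:M.
Proof.
move=> du; rewrite /partial /graph_immersion.
rewrite (derive_col_mx_scalar (f := id))//.
by rewrite derive_id.
Qed.

Lemma partial2_graph_immersion (R : realType) (n : nat) (Om : set 'cV[R]_n)
    (hOm : open Om) (u : 'cV[R]_n -> R) (hu : Ck_on 2 Om u)
    (i j : 'I_n) (x : 'cV[R]_n) : Om x ->
  partial i (partial j (graph_immersion u)) x =
  col_mx 0 (partial i (partial j u) x)%:M.
Proof.
move=> Omx; case: hu => _ /(_ j)[duj [_ /(_ i)[duij _]]].
pose f (y : 'cV[R]_n) := col_mx (delta_mx j 0 : 'cV[R]_n) (partial j u y)%:M.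
(* The formula for the first partials holds only on [Om]; as [Om] is open, it holds near x, which
   suffices for differentiating again. *)
have -> : partial i (partial j (graph_immersion u)) x = partial i f x.
  apply: near_eq_derive; have := open_nbhs_nbhs (conj hOm Omx).
  by apply: filterS => y Omy; apply: partial_graph_immersion; exact: duj.
rewrite /partial /f (derive_col_mx_scalar (f := cst _))//; last exact: duij.
by rewrite derive_cst.
Qed.

Lemma weighted_mean_curvature_graph (R : realType) (n : nat)
    (G : 'cV[R]_(n + 1) -> 'M[R]_(n + 1)) (hG : weight_matrix G)
    (Om : set 'cV[R]_n) (hOm : open Om)
    (u : 'cV[R]_n -> R) (hu : Ck_on 2 Om u) (x : 'cV[R]_n) : Om x ->
  weighted_mean_curvature G (graph_immersion u) (upper_normal u) x =
  \tr (ulsubmx (G (graph_conormal u x)) *m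
       \matrix_(i, j) partial i (partial j u) x).
Proof.
move=> Omx; rewrite /weighted_mean_curvature /shape_operator.
set D := \matrix_(i, j) _; set a := grad u x.
set q := graph_conormal u x; have q0 : q != 0 by exact: conormal_neq0.
pose W := Num.sqrt (1 + dot a a).
have W0 : 0 < W by rewrite sqrtr_gt0 ltr_pwDl// dot_ge0.
(* Homogeneity of degree -1, applied with t = 1/W. *)
have GN : G (upper_normal u x) = W *: G q.
  rewrite -(weight_homo hG q0 (t := W^-1)) ?invr_gt0// scalerA mulfV ?gt_eqF//.
  by rewrite scale1r.
pose E : 'M[R]_(n + 1, n) := col_mx 1%:M a^T.
have dX i : partial i (graph_immersion u) x = col i E.
  rewrite partial_graph_immersion; last by case: hu => _ /(_ i)[+ _]; exact.
  rewrite col_col_mx col1; congr col_mx; apply/matrixP => k l.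
  by rewrite !ord1 !mxE eqxx mulr1n.
have dotcol (M : 'M[R]_(n + 1)) i j :
    dot (M *m col i E) (col j E) = (E^T *m M^T *m E) i j.
  rewrite dotE trmx_mul tr_col -!row_mul !mxE.
  by apply: eq_bigr => k _; rewrite !mxE.
have -> : first_form (graph_immersion u) x = 1%:M + a *m a^T.
  apply/matrixP => i j; rewrite mxE !dX -[X in dot X _]mul1mx dotcol trmx1.
  by rewrite mulmx1 tr_col_mx mul_row_col trmx1 mulmx1 trmxK.
have -> : weight_form G (graph_immersion u) (upper_normal u) x =
    W *: (E^T *m G q *m E).
  apply/matrixP => i j; rewrite mxE !dX GN dotcol linearZ /= (weight_sym hG q0).
  by rewrite -scalemxAr -scalemxAl.
(* Second derivatives of the immersion are vertical, so only the last entry 1/W of the normal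
   contributes. *)
have -> : second_form (graph_immersion u) (upper_normal u) x = W^-1 *: D.
  apply/matrixP => i j; rewrite mxE (partial2_graph_immersion hOm hu)//.
  rewrite /upper_normal scale_col_mx dot_col_mx {1}/dot big1 ?add0r; last first.
    by move=> k _; rewrite mxE mul0r.
  by rewrite /dot big_ord1 !mxE eqxx mulr1 mulrC.
rewrite (weight_form_factor (weight_sym hG q0) (weight_ker hG q0)).
set g := 1%:M + _; have gU : g \in unitmx by exact: unitmx_add1_outer.
rewrite -scalemxAr -scalemxAl -!scalemxAr scalerA mulfV ?gt_eqF// scale1r.
by rewrite -!mulmxA mulKmx// mulKVmx.
Qed.

Theorem lemma3 (R : realType) (n : nat)
    (G : 'cV[R]_(n + 1) -> 'M[R]_(n + 1)) (hG : weight_matrix G)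
    (Om : set 'cV[R]_n) (hOm : open Om)
    (H : 'cV[R]_n -> R -> R)
    (u : 'cV[R]_n -> R) (hu : Ck_on 2 Om u)
    (hH : prescribed_wmc_graph G Om H u) :
  forall x : 'cV[R]_n, Om x ->
    posdefmx (\matrix_(i < n, j < n)
      G (col_mx (- grad u x) 1%:M) (lshift 1 i) (lshift 1 j)) /\
    \sum_(i < n) \sum_(j < n)
      G (col_mx (- grad u x) 1%:M) (lshift 1 i) (lshift 1 j) *
      partial i (partial j u) x = H x (u x).
Proof.
move=> x Omx; pose A := ulsubmx (G (graph_conormal u x)).
have -> : \matrix_(i < n, j < n)
    G (col_mx (- grad u x) 1%:M) (lshift 1 i) (lshift 1 j) = A.
  by apply/matrixP => i j; rewrite !mxE.
have Apos : posdefmx A by exact: posdef_ulsubmx.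
split=> //; rewrite -(hH _ Omx) (weighted_mean_curvature_graph hG hOm hu Omx).
(* The trace sums A_ij D_ji, the equation A_ij D_ij; symmetry of [A] reconciles them. *)
rewrite -/A -Apos.1 exchange_big; apply: eq_bigr => j _ /=.
by rewrite mxE; apply: eq_bigr => i _; rewrite !mxE.
Qed.
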